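(* For all integers $n\geq 0$ and $i\geq 1$, $$\bar a_{9i}(9n+6)\equiv 0 \pmod{12},\qquad \bar a_{9i+4}(9n+6)\equiv 0\pmod{12},\qquad \bar a_{9i+8}(9n+6)\equiv 0\pmod{12}.$$
   Context: For an integer $k\geq 1$ let $f_k:=\prod_{n\geq 1}(1-q^{kn})$. For an integer $c\geq1$, the generalized overcubic partition function $\bar a_c(n)$ is defined by the generating function $\sum_{n\geq 0}\bar a_c(n)q^n=\dfrac{f_4^{c-1}}{f_1^2f_2^{2c-3}}$. *)

(* Defs.v *)
From mathcomp Require Import all_boot all_order all_algebra.
Set Implicit Arguments. Unset Strict Implicit. Unset Printing Implicit Defensive.
Import Order.TTheory GRing.Theory Num.Theory.
Local Open Scope ring_scope.

(* Truncated geometric series: sum_{t=0}^{N} q^{m t}, which agrees with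
   1/(1 - q^m) in all coefficients of degree <= N (for m >= 1). *)
Definition geom (m N : nat) : {poly int} := \sum_(t < N.+1) 'X^(m * t).

(* A polynomial whose coefficients of degree <= N agree with the power series
   f_4^{c-1} / (f_1^2 f_2^{2c-3})  (c >= 1), where f_k = prod_{j>=1} (1 - q^{kj}).
   Factors with j > N only affect degrees > N.  For c = 1 the exponent 2c-3 = -1,
   so f_2 appears in the numerator. *)
Definition ovc_trunc (c N : nat) : {poly int} :=
  \prod_(1 <= j < N.+1)
     ((1 - 'X^(4 * j)) ^+ (c - 1) * (geom j N) ^+ 2 *
      (if (2 <= c)%N then (geom (2 * j) N) ^+ (2 * c - 3) else 1 - 'X^(2 * j))).

(* Generalized overcubic partition function \bar a_c(n) (meaningful for c >= 1). *)
Definition abar (c n : nat) : int := (ovc_trunc c n)`_n.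

(* Main.v *)
Require Import Defs.
From mathcomp Require Import all_boot all_order all_algebra.
From mathcomp Require Import ring zify.
From Stdlib Require Import Setoid Morphisms.

(**
With phi(q) the sum of q^(j^2) over all integers j, Gauss' product
phi(-q) = f_1^2 / f_2 (the limit of the q-binomial theorem) turns the
generating function into 1 / (phi(-q) phi(-q^2)^(c-1)).

Modulo 4 the square of a theta function is 1, so the generating function is
phi(-q) or phi(-q) + phi(-q^2) - 1, and 9n+6 is neither a square nor twice one.

Modulo 3, f(q)^9 = f(q^9), so multiplying by a power of phi(-q^2) whose exponent
is a multiple of 9 does not affect the vanishing of the coefficients at 9n+6.
Since phi(q) phi(-q) = phi(-q^2)^2, what remains is phi(q)^(a+1) phi(-q)^a with
a = 4, 2, 0 for the three families.  The relations
phi(q)^2 + phi(-q)^2 = 2 phi(q^2)^2 and phi(q)^4 + phi(-q)^4 = -1 (mod 3), both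
obtained by descent along q -> q^2, reduce these to phi(q)^3 times the square of
phi(q) or phi(q^2), and a sum of two squares is divisible by 3 only if it is
divisible by 9.
*)

Set Implicit Arguments.
Unset Strict Implicit.
Unset Printing Implicit Defensive.

Import GRing.Theory.
Local Open Scope ring_scope.

(** * Congruence of polynomials modulo a power of X *)

Definition eqX (R : nzRingType) (N : nat) (p q : {poly R}) : Prop :=
  forall k, (k <= N)%N -> p`_k = q`_k.

Notation "p =[ N ] q" := (eqX N p q)
  (at level 70, N at level 0, format "p  =[ N ]  q").

Section EqX.
Variables (R : comNzRingType) (N : nat).
Implicit Types p q r : {poly R}.

Lemma eqX_refl p : p =[N] p. Proof. by []. Qed.

Lemma eqX_eq p q : p = q -> p =[N] q. Proof. by move->. Qed.

Lemma eqX_sym p q : p =[N] q -> q =[N] p.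
Proof. by move=> h k hk; rewrite h. Qed.

Lemma eqX_trans p q r : p =[N] q -> q =[N] r -> p =[N] r.
Proof. by move=> h1 h2 k hk; rewrite h1 ?h2. Qed.

#[global] Instance eqX_equivalence : Equivalence (@eqX R N).
Proof. split; [exact: eqX_refl | exact: eqX_sym | exact: eqX_trans]. Qed.

#[global] Instance eqX_add_proper :
  Proper (@eqX R N ==> @eqX R N ==> @eqX R N) (@GRing.add {poly R}).
Proof. by move=> p p' hp q q' hq k hk; rewrite !coefD hp ?hq. Qed.

#[global] Instance eqX_opp_proper :
  Proper (@eqX R N ==> @eqX R N) (@GRing.opp {poly R}).
Proof. by move=> p p' hp k hk; rewrite !coefN hp. Qed.

#[global] Instance eqX_mul_proper :
  Proper (@eqX R N ==> @eqX R N ==> @eqX R N) (@GRing.mul {poly R}).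
Proof.
move=> p p' hp q q' hq k hk; rewrite !coefM; apply: eq_bigr => j _.
by rewrite hp ?hq //; [exact: leq_trans (leq_subr _ _) hk | have := ltn_ord j; lia].
Qed.

#[global] Instance eqX_exp_proper :
  Proper (@eqX R N ==> eq ==> @eqX R N) (@GRing.exp {poly R}).
Proof.
move=> p p' hp n _ <-; elim: n => [|n IHn]; first by rewrite !expr0.
by rewrite !exprS IHn hp.
Qed.

#[global] Instance eqX_natmul_proper :
  Proper (@eqX R N ==> eq ==> @eqX R N) (@GRing.natmul {poly R}).
Proof. by move=> p p' hp n _ <- k hk; rewrite !coefMn hp. Qed.

Lemma eqX_comp_Xn m p q :
  (0 < m)%N -> p =[N] q -> p \Po 'X^m =[N] q \Po 'X^m.
Proof.
move=> m_gt0 h k hk; rewrite !coef_comp_poly_Xn //; case: ifP => // _.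
by rewrite h // (leq_trans (leq_div _ _)).
Qed.

Lemma eqX_Xn m : (N < m)%N -> ('X^m : {poly R}) =[N] 0.
Proof. by move=> hm k hk; rewrite coefXn coef0; case: eqP => //; lia. Qed.

(** Stands in for division of power series: with constant term 1 in [r], all other terms at degree
    [k] involve [p] or [q] below [k] only. *)
Lemma eqX_mulI r p q : r`_0 = 1 -> r * p =[N] r * q -> p =[N] q.
Proof.
move=> r0 h k; elim/ltn_ind: k => k IHk hk.
have := h k hk; rewrite !coefM !big_ord_recl !subn0 r0 !mul1r.
suff -> : \sum_(i < k) r`_(lift ord0 i) * p`_(k - lift ord0 i) =
          \sum_(i < k) r`_(lift ord0 i) * q`_(k - lift ord0 i) by move/addIr.
by apply: eq_bigr => i _; rewrite IHk //=; have := ltn_ord i; rewrite /bump /=; lia.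
Qed.

Lemma eqX_sum (I : eqType) (s : seq I) (F G : I -> {poly R}) :
  (forall i, i \in s -> F i =[N] G i) ->
  \sum_(i <- s) F i =[N] \sum_(i <- s) G i.
Proof.
elim: s => [|i s IHs] h; first by rewrite !big_nil.
rewrite !big_cons (h i (mem_head i s)) IHs // => j hj.
by apply: h; rewrite inE hj orbT.
Qed.

Lemma eqX_prod_trunc (F : nat -> {poly R}) m M M' : (m <= M <= M')%N ->
  (forall j, (M <= j)%N -> F j =[N] 1) ->
  \prod_(m <= j < M') F j =[N] \prod_(m <= j < M) F j.
Proof.
move=> /andP[hm hM] h; rewrite (big_cat_nat hm hM) /=.
suff -> : \prod_(M <= j < M') F j =[N] 1 by rewrite mulr1.
rewrite big_nat; elim/big_rec: _ => // i p /andP[hi _] ->.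
by rewrite h // mulr1.
Qed.

End EqX.

Lemma eqX_map (R S : comNzRingType) (f : {rmorphism R -> S}) N (p q : {poly R}) :
  p =[N] q -> map_poly f p =[N] map_poly f q.
Proof. by move=> h k hk; rewrite !coef_map h. Qed.

(** * The q-binomial theorem *)

Section QBinomial.
Variable R : comNzRingType.
Implicit Types x a b : R.

(** The Gaussian binomial coefficient, given by the q-Pascal rule because [R] has no quotients. *)
Fixpoint qbin x (n k : nat) : R :=
  match n, k with
  | _, 0%N => 1
  | 0%N, _.+1 => 0
  | n'.+1, k'.+1 => qbin x n' k' + x ^+ k * qbin x n' k
  end.

(** The q-Pochhammer product [(x; x)_n]; at [x = 'X^m] it truncates f_m. *)
Definition qfact x (n : nat) : R := \prod_(1 <= j < n.+1) (1 - x ^+ j).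

Lemma qfactS x n : qfact x n.+1 = qfact x n * (1 - x ^+ n.+1).
Proof. by rewrite /qfact big_nat_recr. Qed.

Lemma qbin0 x n : qbin x n 0 = 1. Proof. by case: n. Qed.

Lemma qbinS x n k : qbin x n.+1 k.+1 = qbin x n k + x ^+ k.+1 * qbin x n k.+1.
Proof. by []. Qed.

Lemma qbin_small x n k : (n < k)%N -> qbin x n k = 0.
Proof.
elim: n k => [|n IHn] [|k] //= hk.
by rewrite !IHn ?mulr0 ?addr0 //; lia.
Qed.

Lemma qbin_qfact x n k : (k <= n)%N ->
  qbin x n k * qfact x k * qfact x (n - k) = qfact x n.
Proof.
elim: n k => [|n IHn] [|k] hk.
- by rewrite /qfact !big_nil /= !mul1r.
- by [].
- by rewrite qbin0 /qfact big_nil !mul1r subn0.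
rewrite qbinS subSS; have := IHn k hk.
case: (leqP k.+1 n) => hk1.
  have := IHn k.+1 hk1.
  have -> : (n - k = (n - k.+1).+1)%N by lia.
  rewrite !qfactS => e1 e2.
  have -> : x ^+ n.+1 = x ^+ k.+1 * x ^+ (n - k.+1).+1 by rewrite -exprD; congr (_ ^+ _); lia.
  (* Splits [1 - x^(n+1)] as [(1 - x^(k+1)) + x^(k+1) (1 - x^(n-k))], one summand for each term of
     the Pascal rule. *)
  transitivity ((1 - x ^+ k.+1) * qfact x n
     + x ^+ k.+1 * (1 - x ^+ (n - k.+1).+1) * qfact x n); last by ring.
  by rewrite -{1}e2 -e1; ring.
have -> : k = n by lia.
rewrite (qbin_small _ (ltnSn n)) mulr0 addr0 => e.
by rewrite [in RHS]qfactS -e !qfactS; ring.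
Qed.

Lemma qbinomial x a b n :
  \prod_(0 <= j < n) (a + b * x ^+ j) =
  \sum_(0 <= k < n.+1) qbin x n k * x ^+ 'C(k, 2) * a ^+ (n - k) * b ^+ k.
Proof.
elim: n b => [|n IHn] b.
  by rewrite big_nil big_nat1 /= !expr0 !mulr1.
rewrite big_nat_recl // expr0 mulr1.
under eq_bigr => j _ do rewrite exprS mulrA.
(* Removing the factor [j = 0] turns [b] into [b * x] in the rest; [T k] is the resulting term of
   the induction hypothesis. *)
pose T k := qbin x n k * x ^+ ('C(k, 2) + k) * a ^+ (n - k) * b ^+ k.
rewrite IHn [X in _ * X](eq_bigr T) => [|k _]; last by rewrite /T exprMn exprD; ring.
rewrite [RHS]big_nat_recl //= expr0 !mulr1 mul1r.
have -> : \sum_(0 <= i < n.+1) (qbin x n i + x ^+ i.+1 * qbin x n i.+1)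
     * x ^+ 'C(i.+1, 2) * a ^+ (n.+1 - i.+1) * b ^+ i.+1
  = \sum_(0 <= i < n.+1) b * T i + \sum_(0 <= i < n.+1) a * T i.+1.
  rewrite -big_split /=; apply: eq_big_nat => i /andP[_ hi].
  rewrite /T binS bin1 subSS; case: (leqP i.+1 n) => hin.
    have -> : (n - i = (n - i.+1).+1)%N by lia.
    by rewrite !exprD !exprS; ring.
  by rewrite (qbin_small _ hin) !exprD !exprS; ring.
rewrite [X in _ + (_ + X)]big_nat_recr //= {4}/T (qbin_small _ (ltnSn n)) !mul0r mulr0 addr0.
rewrite mulrDl addrCA addrC -!mulr_sumr; congr (_ + _).
by rewrite [in LHS]big_nat_recl //= mulrDr mulr_sumr /T qbin0 subn0 !expr0 exprS !mulr1 mul1r.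
Qed.

End QBinomial.

(** * Theta functions *)

Section Theta.
Variable R : comNzRingType.
Implicit Types (s : R) (m N : nat).

(* The truncation of phi(s q^m), where phi(q) is the sum of q^(j^2) over all
   integers j; it is only used for s = 1 and s = -1, so that s^(j^2) = s^j. *)
Definition theta s m N : {poly R} :=
  1 + (\sum_(1 <= j < N.+1) s%:P ^+ j * 'X^(m * j ^ 2)) *+ 2.

Definition oddprod s N : {poly R} := \prod_(0 <= j < N) (1 + s%:P * 'X^(j.*2.+1)).

Lemma theta_trunc s N M : (N <= M)%N -> theta s 1 M =[N] theta s 1 N.
Proof.
move=> h; rewrite /theta (@big_cat_nat _ _ _ N.+1 1 M.+1) //=.
suff -> : \sum_(N.+1 <= j < M.+1) s%:P ^+ j * 'X^(1 * j ^ 2) =[N] 0 by rewrite addr0.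
rewrite big_nat; elim/big_rec: _ => // i p /andP[hi _] ->.
by rewrite eqX_Xn ?mulr0 ?addr0 // mul1n; nia.
Qed.

Lemma theta_comp s m N : theta s m N = theta s 1 N \Po 'X^m.
Proof.
rewrite /theta comp_polyD comp_polyC rmorphMn rmorph_sum; congr (_ + _ *+ _).
apply: eq_bigr => j _; rewrite /= comp_polyM -rmorphXn comp_polyC; congr (_ * _).
by rewrite comp_Xn_poly -exprM mul1n.
Qed.

Lemma theta_comp2 s m N : theta s m N \Po 'X^2 = theta s (m * 2) N.
Proof.
rewrite theta_comp -comp_polyA comp_Xn_poly -exprM [RHS]theta_comp.
by rewrite mulnC.
Qed.

Lemma oddprod_trunc s N M : (N <= M)%N -> oddprod s M =[N] oddprod s N.
Proof.
move=> h; apply: eqX_prod_trunc => // j hj.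
by rewrite eqX_Xn ?mulr0 ?addr0 //; lia.
Qed.

Lemma qfact_trunc m N M : (0 < m)%N -> (N <= M)%N ->
  qfact ('X^m : {poly R}) M =[N] qfact 'X^m N.
Proof.
move=> m_gt0 h; apply: eqX_prod_trunc => // j hj.
by rewrite -exprM eqX_Xn ?subr0 //; nia.
Qed.

Lemma coef0_qfact m N : (0 < m)%N -> (qfact ('X^m : {poly R}) N)`_0 = 1.
Proof.
move=> m_gt0; rewrite /qfact big_nat; elim/big_rec: _ => [|j p /andP[hj _] h].
  by rewrite coef1.
rewrite coef0M h mulr1 -exprM coefB coef1 coefXn.
have : (0 < m * j)%N by rewrite muln_gt0 m_gt0.
by case: (m * j)%N => // k _; rewrite subr0.
Qed.

Lemma Xn_mulI n (p q : {poly R}) : 'X^n * p = 'X^n * q -> p = q.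
Proof.
move=> h; apply/polyP => i; move/polyP/(_ (n + i)%N): h.
by rewrite !coefXnM ltnNge leq_addr addKn.
Qed.

Lemma signC s : s * s = 1 -> s%:P * s%:P = 1 :> {poly R}.
Proof. by move=> h; rewrite -polyCM h. Qed.

Lemma sign_even s k : s * s = 1 -> s%:P ^+ k.*2 = 1 :> {poly R}.
Proof. by move=> h; rewrite -muln2 mulnC exprM expr2 signC // expr1n. Qed.

(** With truncated subtraction the squared quantity is the distance from [k] to [n], so this is the
    theta sum recentred at [n]; since [s * s = 1], only the parity of [n + k] affects the sign. *)
Lemma sum_sq_dist s n : s * s = 1 ->
  \sum_(0 <= k < n.*2.+1) s%:P ^+ (n + k) * 'X^(((k - n) + (n - k)) ^ 2) = theta s 1 n.
Proof.
move=> hs; rewrite (@big_cat_nat _ _ _ n) //=; last by lia.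
rewrite [X in _ + X]big_ltn; last by lia.
rewrite subnn exp0n // addnn sign_even // mul1r /theta addrCA; congr (_ + _).
rewrite mulr2n; congr (_ + _).
  rewrite big_add1 /= big_nat_rev /=; apply: eq_big_nat => j /andP[_ hj].
  have -> : (n + (0 + n - j.+1) = (n - j.+1).*2 + j.+1)%N by lia.
  rewrite exprD sign_even // mul1r mul1n; congr (_ * 'X^(_ ^ 2)); lia.
rewrite -{1}[n.+1]addn1 addnC big_addn.
have -> : (n.*2.+1 - n = n.+1)%N by lia.
apply: eq_big_nat => j /andP[hj _].
have -> : (n + (j + n) = n.*2 + j)%N by lia.
by rewrite exprD sign_even // mul1r mul1n; congr (_ * 'X^(_ ^ 2)); lia.
Qed.

(* The q-binomial theorem for the product of X^(2n) + s X^(2j+1) over j < 2n,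
   after removing the power X^(3 n^2) that both sides share. *)
Lemma oddprod_sq s n : s * s = 1 ->
  oddprod s n ^+ 2 = \sum_(0 <= k < n.*2.+1)
    qbin 'X^2 n.*2 k * (s%:P ^+ (n + k) * 'X^(((k - n) + (n - k)) ^ 2)).
Proof.
move=> hs; apply: (@Xn_mulI (3 * n ^ 2)).
have := @qbinomial {poly R} 'X^2 'X^(n.*2) (s%:P * 'X) n.*2.
have -> : \prod_(0 <= j < n.*2) ('X^(n.*2) + s%:P * 'X * 'X^2 ^+ j)
   = s%:P ^+ n * ('X^(3 * n ^ 2) * oddprod s n ^+ 2).
  rewrite (@big_cat_nat _ _ _ n) //=; last by lia.
  (* For [j < n] the power taken out is [s X^(2j+1)], leaving [1 + s X^(2(n-j)-1)] because
     [s * s = 1]; for [j >= n] it is [X^(2n)]. *)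
  have -> : \prod_(0 <= j < n) ('X^(n.*2) + s%:P * 'X * 'X^2 ^+ j)
     = s%:P ^+ n * 'X^(n ^ 2) * oddprod s n.
    have -> : oddprod s n = \prod_(0 <= j < n) (1 + s%:P * 'X^((n - j.+1).*2.+1)).
      by rewrite /oddprod big_nat_rev.
    have -> : s%:P ^+ n * 'X^(n ^ 2) = \prod_(0 <= j < n) (s%:P * 'X^(j.*2.+1)).
      elim: {+}n => [|k IHk]; first by rewrite big_nil !expr0 mulr1.
      rewrite big_nat_recr //= -IHk.
      have -> : (k.+1 ^ 2 = k ^ 2 + k.*2.+1)%N by lia.
      by rewrite exprS exprD; ring.
    rewrite -big_split /=; apply: eq_big_nat => j /andP[_ hj].
    rewrite mulrDr mulr1 mulrACA signC // mul1r -exprD -exprM addrC exprS mulrA.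
    have -> : (2 * j = j.*2)%N by lia.
    by congr (_ * _ * _ + 'X^_); lia.
  have -> : \prod_(n <= j < n.*2) ('X^(n.*2) + s%:P * 'X * 'X^2 ^+ j)
     = 'X^(2 * n ^ 2) * oddprod s n.
    rewrite -{1}[n]add0n big_addn -addnn addnK.
    have -> : 'X^(2 * n ^ 2) = \prod_(0 <= j < n) 'X^(n.*2) :> {poly R}.
      by rewrite prodr_const_nat subn0 -exprM; congr ('X^_); lia.
    rewrite -big_split /=; apply: eq_big_nat => j _.
    rewrite mulrDr mulr1 addnn; congr (_ + _).
    rewrite -exprM mulrCA -exprD -mulrA -exprS.
    by congr (_ * 'X^_); lia.
  have -> : (3 * n ^ 2 = n ^ 2 + 2 * n ^ 2)%N by lia.
  by rewrite exprD; ring.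
move/(congr1 (fun p => s%:P ^+ n * p)); rewrite mulrA -exprD addnn sign_even // mul1r => ->.
rewrite !mulr_sumr; apply: eq_big_nat => k /andP[_ hk].
rewrite -!exprM [(s%:P * 'X) ^+ k]exprMn [s%:P ^+ (n + k)]exprD.
have : 'X^(2 * 'C(k, 2)) * 'X^(n.*2 * (n.*2 - k)) * 'X^k
  = 'X^(3 * n ^ 2) * 'X^((k - n + (n - k)) ^ 2) :> {poly R}.
  rewrite -!exprD; congr ('X^_).
  (* This gives [2 * 'C(k, 2) = k * (k - 1)], so both exponents equal [k^2 - 2nk + 4n^2]. *)
  have := mul_bin_diag k 1; rewrite bin1; move: 'C(k, 2) => c hc.
  nia.
move=> e; transitivity (s%:P ^+ n * s%:P ^+ k * qbin 'X^2 n.*2 k *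
  ('X^(2 * 'C(k, 2)) * 'X^(n.*2 * (n.*2 - k)) * 'X^k)); first by ring.
by rewrite e; ring.
Qed.

End Theta.

(** * Product formulas for the theta series *)

Section ThetaProduct.
Variable R : comNzRingType.
Implicit Types (s : R) (m N : nat).

(** Since [k] and [n - k] are at least [N], the three products in [qbin_qfact] all agree with
    [qfact 'X^m N] up to degree [N], and one copy cancels. *)
Lemma qbin_limit m N n k : (0 < m)%N -> (N <= k)%N -> (N + k <= n)%N ->
  qfact ('X^m : {poly R}) N * qbin 'X^m n k =[N] 1.
Proof.
move=> m_gt0 hk hn; apply: (@eqX_mulI _ _ (qfact 'X^m N)); first exact: coef0_qfact.
have kn : (k <= n)%N by lia.
have := qbin_qfact ('X^m : {poly R}) kn => e.
rewrite mulr1 -[X in _ =[_] X](@qfact_trunc R m N n) //; last by lia.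
rewrite -e -{1}(@qfact_trunc R m N k) // -(@qfact_trunc R m N (n - k)) //; last by lia.
by apply: eqX_eq; ring.
Qed.

(** Jacobi's triple product at z = s = 1/s, as the limit of [oddprod_sq]. *)
Lemma theta_product s N : s * s = 1 ->
  theta s 1 N =[N] qfact 'X^2 N * oddprod s N ^+ 2.
Proof.
(* Size [N.*2] leaves enough room: terms at distance over [N] from the centre have degree above [N],
   and the others satisfy [N <= k <= 3N], as [qbin_limit] requires. *)
move=> hs; have hN : (N <= N.*2)%N by lia.
rewrite -(theta_trunc s hN) -(oddprod_trunc s hN) oddprod_sq // -sum_sq_dist //.
rewrite mulr_sumr; apply: eqX_sum => k; rewrite mem_index_iota => /andP[_ hk].
have [hd|hd] := leqP (k - N.*2 + (N.*2 - k)) N; last first.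
  by rewrite (@eqX_Xn R N (_ ^ 2)); [rewrite !mulr0 | nia].
by rewrite mulrA qbin_limit ?mul1r //; lia.
Qed.

(** The factors of f_1 of even index form f_2, those of odd index [oddprod (-1)]. *)
Lemma qfact_oddprod N : qfact 'X^1 N =[N] qfact 'X^2 N * oddprod (-1 : R) N.
Proof.
have hN : (N <= N.*2)%N by lia.
rewrite -(@qfact_trunc R 1 N _ isT hN) expr1.
suff -> : qfact 'X^1 N.*2 = qfact 'X^2 N * oddprod (-1 : R) N by [].
rewrite /qfact /oddprod big_add1 /= [X in _ = X * _]big_add1 /=.
elim: {hN} N => [|N IHN]; first by rewrite !big_nil mulr1.
rewrite doubleS !big_nat_recr //= IHN polyCN mulN1r -!exprM !mul1n.
have -> : (2 * N.+1 = N.*2.+2)%N by lia.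
by ring.
Qed.

Lemma qfact_comp m n N :
  qfact ('X^m : {poly R}) N \Po 'X^n = qfact 'X^(m * n) N.
Proof.
rewrite /qfact rmorph_prod; apply: eq_bigr => j _.
by rewrite rmorphB rmorph1 rmorphXn /= comp_Xn_poly mulnC exprM.
Qed.

Lemma theta_neg_qfact N :
  theta (-1 : R) 1 N * qfact 'X^2 N =[N] qfact 'X^1 N ^+ 2.
Proof.
rewrite theta_product ?mulrNN ?mulr1 // qfact_oddprod.
by apply: eqX_eq; ring.
Qed.

Lemma theta_neg_qfact2 N :
  theta (-1 : R) 2 N * qfact 'X^4 N =[N] qfact 'X^2 N ^+ 2.
Proof.
have := eqX_comp_Xn (isT : (0 < 2)%N) (@theta_neg_qfact N).
by rewrite comp_polyM rmorphXn /= theta_comp2 !qfact_comp.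
Qed.

Lemma oddprod_mulN N : oddprod (1 : R) N * oddprod (-1) N = oddprod (-1) N \Po 'X^2.
Proof.
rewrite /oddprod -big_split /= rmorph_prod; apply: eq_bigr => j _.
rewrite rmorphD rmorphM rmorph1 /= comp_polyC comp_Xn_poly -exprM mulnC exprM.
by rewrite polyCN; ring.
Qed.

(** In product form, [oddprod_mulN] moves the odd products to q^2, and [qfact_oddprod] at q^2
    expresses f_2 through f_4. *)
Lemma theta_mulN N : theta (1 : R) 1 N * theta (-1) 1 N =[N] theta (-1) 2 N ^+ 2.
Proof.
have hodd := eqX_comp_Xn (isT : (0 < 2)%N) (@qfact_oddprod N).
have hs : (-1 : R) * -1 = 1 by rewrite mulrNN mulr1.
have htheta := eqX_comp_Xn (isT : (0 < 2)%N) (@theta_product _ N hs).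
move: hodd htheta; rewrite !comp_polyM theta_comp2 !qfact_comp -oddprod_mulN => hodd ->.
rewrite !theta_product ?mulrNN ?mulr1 // hodd.
by apply: eqX_eq; ring.
Qed.

End ThetaProduct.

(** * Additive identities between theta series *)

Section ThetaIdentities.
Variable R : comNzRingType.
Implicit Types (s : R) (m N : nat).

Lemma coef_theta_eq0 s m N k : (forall j, k != m * j ^ 2)%N -> (theta s m N)`_k = 0.
Proof.
move=> h; rewrite coefD coefMn coef_sum big1 => [|j _].
  by rewrite mul0rn addr0 coef1; have := h 0%N; rewrite muln0 => /negPf ->.
by rewrite -rmorphXn coefCM coefXn (negPf (h j)) mulr0.
Qed.

Lemma coef0_theta s m N : (0 < m)%N -> (theta s m N)`_0 = 1.
Proof.
move=> m_gt0; rewrite coefD coefMn coef1 coef_sum big_nat big1 => [|j /andP[hj _]].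
  by rewrite mul0rn addr0.
have : (0 < m * j ^ 2)%N by rewrite muln_gt0 m_gt0 expn_gt0 hj.
by rewrite -rmorphXn coefCM coefXn; case: (m * j ^ 2)%N => // k _; rewrite mulr0.
Qed.

(** Terms with odd [j] cancel, and [j = 2i] gives the exponent [4i^2]; truncating the left side at
    [N.*2] makes the sums match exactly. *)
Lemma theta_addN N : theta (1 : R) 1 N + theta (-1) 1 N =[N] theta 1 4 N *+ 2.
Proof.
have hN : (N <= N.*2)%N by lia.
rewrite -(theta_trunc 1 hN) -(theta_trunc (-1) hN) /theta.
suff e : \sum_(1 <= j < N.*2.+1) ((1 : R)%:P ^+ j + (-1 : R)%:P ^+ j) * 'X^(1 * j ^ 2)
    = (\sum_(1 <= j < N.+1) (1 : R)%:P ^+ j * 'X^(4 * j ^ 2)) *+ 2.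
  apply: eqX_eq; rewrite addrACA -mulrnDl -big_split /=.
  by under eq_bigr => j _ do rewrite -mulrDl; rewrite e; ring.
rewrite -sumrMnl !big_add1 /=.
elim: {hN} N => [|N IHN]; first by rewrite !big_nil.
rewrite doubleS !big_nat_recr //= IHN polyCN polyC1 !expr1n !mul1n.
rewrite !(exprS (-1 : {poly R})) -signr_odd odd_double expr0.
have -> : (N.*2.+2 ^ 2 = 4 * N.+1 ^ 2)%N by lia.
by ring.
Qed.

(** The coefficient of [h \Po 'X^2] at [k > 0] is zero or that of [h] at [k / 2 < k]. *)
Lemma eqX0_descent (a : R) N (h : {poly R}) :
  h`_0 = 0 -> h =[N] a%:P * (h \Po 'X^2) -> h =[N] 0.
Proof.
move=> h0 e; elim/ltn_ind => -[|k] IHk hk; first by rewrite h0 coef0.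
rewrite e // coefCM coef_comp_poly_Xn //; case: ifP => _; last by rewrite mulr0 coef0.
by rewrite IHk ?coef0 ?mulr0 //; lia.
Qed.

(** The difference [f] of the two sides satisfies f(q) = -2 f(q^2): square [theta_addN] and rewrite
    the mixed product by [theta_mulN]. *)
Lemma theta_sq_addN N :
  theta (1 : R) 1 N ^+ 2 + theta (-1) 1 N ^+ 2 =[N] theta 1 2 N ^+ 2 *+ 2.
Proof.
pose f : {poly R} := theta 1 1 N ^+ 2 + theta (-1) 1 N ^+ 2 - theta 1 2 N ^+ 2 *+ 2.
suff hf : f =[N] 0.
  have -> : theta 1 1 N ^+ 2 + theta (-1) 1 N ^+ 2 = f + theta 1 2 N ^+ 2 *+ 2.
    by rewrite /f; ring.
  by rewrite hf add0r.
apply: (@eqX0_descent (- 2%:R)).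
  rewrite coefB coefMn coefD !expr2 !coef0M !coef0_theta //; ring.
have -> : f \Po 'X^2 = theta 1 2 N ^+ 2 + theta (-1) 2 N ^+ 2 - theta 1 4 N ^+ 2 *+ 2.
  by rewrite /f rmorphB rmorphMn rmorphD !rmorphXn /= !theta_comp2.
have -> : f = (theta 1 1 N + theta (-1) 1 N) ^+ 2
   - (theta 1 1 N * theta (-1) 1 N + theta 1 2 N ^+ 2) *+ 2 by rewrite /f; ring.
rewrite theta_addN theta_mulN polyCN polyC_natr.
by apply: eqX_eq; ring.
Qed.

(** Squaring [theta_sq_addN] gives f(q) = 4 phi(q^2)^4 - 2 phi(-q^2)^4 + 1 for the difference [f] of
    the two sides, and this is f(q^2) modulo 3. *)
Lemma theta_pow4_addN N : 3%:R = 0 :> R ->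
  theta (1 : R) 1 N ^+ 4 + theta (-1) 1 N ^+ 4 =[N] - 1.
Proof.
move=> R3; have P3 : 3%:R = 0 :> {poly R} by rewrite -polyC_natr R3.
pose f : {poly R} := theta 1 1 N ^+ 4 + theta (-1) 1 N ^+ 4 + 1.
suff hf : f =[N] 0.
  have -> : theta 1 1 N ^+ 4 + theta (-1) 1 N ^+ 4 = f - 1 by rewrite /f; ring.
  by rewrite hf add0r.
apply: (@eqX0_descent 1).
  rewrite /f !coefD coef1 !(exprS _ 3) !(exprS _ 2) !expr2 !coef0M !coef0_theta //.
  by rewrite /= -[RHS]R3; ring.
have -> : f \Po 'X^2 = theta 1 2 N ^+ 4 + theta (-1) 2 N ^+ 4 + 1.
  by rewrite /f !comp_polyD comp_polyC !rmorphXn /= !theta_comp2.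
have -> : f = (theta 1 1 N ^+ 2 + theta (-1) 1 N ^+ 2) ^+ 2
   - (theta 1 1 N * theta (-1) 1 N) ^+ 2 *+ 2 + 1 by rewrite /f; ring.
rewrite theta_sq_addN theta_mulN; apply: eqX_eq; rewrite polyC1 mul1r.
transitivity (theta (1 : R) 2 N ^+ 4 + theta (-1) 2 N ^+ 4 + 1
  + 3%:R * (theta (1 : R) 2 N ^+ 4 - theta (-1) 2 N ^+ 4)); first by ring.
by rewrite P3 mul0r addr0.
Qed.

End ThetaIdentities.

Lemma map_theta (R S : comNzRingType) (f : {rmorphism R -> S}) s m N :
  map_poly f (theta s m N) = theta (f s) m N.
Proof.
rewrite /theta rmorphD rmorph1 rmorphMn rmorph_sum; congr (_ + _ *+ _).
by apply: eq_bigr => j _; rewrite rmorphM rmorphXn /= map_polyC /= map_polyXn.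
Qed.

(** * The generating function *)

Lemma geom_mul m N : (0 < m)%N -> geom m N * (1 - 'X^m) =[N] 1.
Proof.
move=> m_gt0; have -> : geom m N * (1 - 'X^m) = 1 - 'X^(m * N.+1).
  rewrite /geom exprM -[RHS]opprB subrX1 mulrC -mulNr opprB; congr (_ * _).
  by apply: eq_bigr => t _; rewrite exprM.
by rewrite eqX_Xn ?subr0 //; nia.
Qed.

Lemma prod_geom_mul m N : (0 < m)%N ->
  (\prod_(1 <= j < N.+1) geom (m * j) N) * qfact 'X^m N =[N] 1.
Proof.
move=> m_gt0; rewrite -big_split /= big_nat; elim/big_rec: _ => // j p /andP[hj _] ->.
by rewrite mulr1 -exprM geom_mul // muln_gt0 m_gt0.
Qed.

(** The generating function regroups as (f_2 / f_1^2) (f_4 / f_2^2)^(c-1), whose factors are inverse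
    theta series by Gauss' product. *)
Lemma ovc_trunc_theta c N : (2 <= c)%N ->
  ovc_trunc c N * (theta (-1) 1 N * theta (-1) 2 N ^+ (c - 1)) =[N] 1.
Proof.
move=> hc; have [d ->] : exists d, c = d.+2 by exists (c - 2)%N; lia.
have -> : ovc_trunc d.+2 N = qfact 'X^4 N ^+ d.+1 *
   (\prod_(1 <= j < N.+1) geom (1 * j) N) ^+ 2 *
   (\prod_(1 <= j < N.+1) geom (2 * j) N) ^+ (d.*2.+1).
  rewrite /ovc_trunc /qfact -!prodrXl -!big_split /=; apply: eq_bigr => j _.
  by rewrite mul1n exprM; congr (_ ^+ _ * _ * _ ^+ _); lia.
rewrite subn1 /=.
have h1 := @prod_geom_mul 1 N isT; have h2 := @prod_geom_mul 2 N isT.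
move: h1 h2; set G1 := \prod_(_ <= _ < _) _; set G2 := \prod_(_ <= _ < _) _ => h1 h2.
apply: (@eqX_mulI _ _ (qfact 'X^2 N * qfact 'X^4 N ^+ d.+1)).
  rewrite coef0M coef0_qfact // mul1r.
  elim: d {hc} => [|d IH]; rewrite ?expr1 ?coef0_qfact //.
  by rewrite exprS coef0M coef0_qfact // IH mulr1.
transitivity (@GRing.mul {poly int} (qfact 'X^4 N ^+ d.+1 * G1 ^+ 2 *
    G2 ^+ d.*2.+1 * (theta (-1) 1 N * qfact 'X^2 N)) ((theta (-1) 2 N * qfact 'X^4 N) ^+ d.+1)).
  by apply: eqX_eq; rewrite exprMn; ring.
rewrite theta_neg_qfact theta_neg_qfact2.
transitivity (@GRing.mul {poly int} (qfact 'X^4 N ^+ d.+1 * (G1 * qfact 'X^1 N) ^+ 2)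
    ((G2 * qfact 'X^2 N) ^+ d.*2.+1 * qfact 'X^2 N)).
  apply: eqX_eq; rewrite -exprM !exprMn.
  have -> : (2 * d.+1 = d.*2.+1.+1)%N by lia.
  by rewrite (exprS _ d.*2.+1); ring.
by rewrite h1 h2 !expr1n; apply: eqX_eq; ring.
Qed.

Lemma ovc_trunc_theta_map (R : comNzRingType) c N : (2 <= c)%N ->
  map_poly intr (ovc_trunc c N) *
    (theta (-1 : R) 1 N * theta (-1) 2 N ^+ (c - 1)) =[N] 1.
Proof.
move=> hc; have := @eqX_map _ _ (intr : {rmorphism int -> R}) _ _ _ (@ovc_trunc_theta c N hc).
by rewrite !rmorphM rmorph1 rmorphXn /= !map_theta rmorphN1.
Qed.

Lemma sqn_mod9 j : (j ^ 2 %% 9)%N \in [:: 0; 1; 4; 7]%N.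
Proof.
rewrite -modnXm; have : (j %% 9 < 9)%N by rewrite ltn_mod.
by move: (j %% 9)%N => r; do 9?[case: r => [|r] //].
Qed.

Lemma coef_theta_mod9 (R : comNzRingType) (s : R) m N k :
  (k %% 9)%N \notin [seq (m * a %% 9)%N | a <- [:: 0; 1; 4; 7]%N] ->
  (theta s m N)`_k = 0.
Proof.
move=> hk; apply: coef_theta_eq0 => j; apply: contraNneq hk => ->.
by rewrite -modnMmr; apply: (map_f (fun a => m * a %% 9)%N); exact: sqn_mod9.
Qed.

(** * Divisibility by 4 *)

Lemma intr_Zp_eq0 m (x : int) : (1 < m)%N -> (x%:~R == 0 :> 'Z_m) = (m %| x)%Z.
Proof.
move=> m_gt1; have h (n : nat) : ((n%:R : 'Z_m) == 0) = (m %| n)%N.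
  by rewrite -(inj_eq val_inj) /= val_Zp_nat.
rewrite /dvdz; case: x => n /=; first exact: h.
by rewrite NegzE mulrNz oppr_eq0; exact: (h n.+1).
Qed.

Lemma theta_sq_char4 (R : comNzRingType) (s : R) m N :
  4%:R = 0 :> R -> theta s m N ^+ 2 = 1.
Proof.
move=> R4; have P4 : 4%:R = 0 :> {poly R} by rewrite -polyC_natr R4.
rewrite /theta; set t := \sum_(_ <= _ < _) _.
by transitivity (1 + 4%:R * (t + t ^+ 2)); [ring | rewrite P4 mul0r addr0].
Qed.

Lemma coef_ovc_trunc_char4 (R : comNzRingType) c n : 4%:R = 0 :> R -> (2 <= c)%N ->
  (map_poly intr (ovc_trunc c (9 * n + 6)) : {poly R})`_(9 * n + 6) = 0.
Proof.
move=> R4 hc; set N := (9 * n + 6)%N.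
have P4 : 4%:R = 0 :> {poly R} by rewrite -polyC_natr R4.
have hA := @ovc_trunc_theta_map R c N hc.
have N6 : (N %% 9 = 6)%N by rewrite /N; lia.
(* Modulo 9 the exponents present are 0, 1, 4, 7 in the first series and 0, 2, 5, 8 in the
   second. *)
have z1 : (theta (-1 : R) 1 N)`_N = 0 by apply: coef_theta_mod9; rewrite N6.
have z2 : (theta (-1 : R) 2 N)`_N = 0 by apply: coef_theta_mod9; rewrite N6.
set P := theta (-1) 1 N in hA z1; set P' := theta (-1) 2 N in hA z2.
have PP : P ^+ 2 = 1 by apply: theta_sq_char4.
have PP' : P' ^+ 2 = 1 by apply: theta_sq_char4.
(* The product [P * P' ^+ (c - 1)] squares to 1, so it is its own inverse. *)
have {hA}-> : (map_poly intr (ovc_trunc c N) : {poly R})`_N = (P * P' ^+ (c - 1))`_N.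
  suff e : map_poly intr (ovc_trunc c N) =[N] P * P' ^+ (c - 1) by apply: e.
  transitivity (map_poly intr (ovc_trunc c N) * (P * P' ^+ (c - 1)) * (P * P' ^+ (c - 1))).
    rewrite -mulrA -expr2 exprMn -exprM mulnC exprM PP PP' expr1n !mulr1.
    exact: eqX_refl.
  by rewrite hA mul1r.
rewrite -(odd_double_half (c - 1)) exprD -muln2 mulnC exprM PP' expr1n mulr1.
case: odd => /=; last by rewrite expr0 mulr1.
have -> : P * P' = P + P' - 1.
  rewrite /P /P' /theta; set t := \sum_(_ <= _ < _) _; set u := \sum_(_ <= _ < _) _.
  by transitivity (1 + t *+ 2 + (1 + u *+ 2) - 1 + 4%:R * (t * u)); [ring | rewrite P4 mul0r addr0].
by rewrite coefB coefD z1 z2 coef1 /N addnS addr0 subr0.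
Qed.

(** * Divisibility by 3 *)

Lemma frobenius_F3 (p : {poly 'F_3}) : p ^+ 3 = p \Po 'X^3.
Proof.
have P3 : 3%:R = 0 :> {poly 'F_3} by rewrite -polyC_natr (_ : 3%:R = 0) //; apply/eqP.
elim/poly_ind: p => [|p c IHp]; first by rewrite comp_poly0 expr0n.
rewrite comp_polyD comp_polyM comp_polyX comp_polyC -IHp.
have hc : c%:P ^+ 3 = c%:P.
  by rewrite -rmorphXn; congr (_%:P); apply/eqP; case: c => [[|[|[|]]]].
transitivity (p ^+ 3 * 'X^3 + c%:P ^+ 3 + 3%:R * ((p * 'X) ^+ 2 * c%:P + p * 'X * c%:P ^+ 2)).
  by ring.
by rewrite P3 mul0r addr0 hc.
Qed.

Lemma frobenius_sq_F3 (p : {poly 'F_3}) : p ^+ 9 = p \Po 'X^9.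
Proof.
have -> : 9%N = (3 * 3)%N by [].
by rewrite !exprM (frobenius_F3 (p ^+ 3)) (frobenius_F3 p) -comp_polyA comp_Xn_poly.
Qed.

(** * Vanishing of coefficients at exponents 6 modulo 9 *)

Section SixModNine.
Variables (R : comNzRingType) (N : nat).
Implicit Types p q : {poly R}.

(** The bound on [k] makes the property invariant under [=[N]]. *)
Definition avoids6 p := forall k, (k <= N)%N -> (k %% 9 = 6)%N -> p`_k = 0.

#[global] Instance avoids6_proper : Proper (@eqX R N ==> iff) avoids6.
Proof.
by move=> p q e; split=> h k hk h6; [rewrite -e | rewrite e] => //; apply: h.
Qed.

Lemma avoids6D p q : avoids6 p -> avoids6 q -> avoids6 (p + q).
Proof. by move=> hp hq k hk h6; rewrite coefD hp ?hq ?addr0. Qed.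

Lemma avoids6N p : avoids6 p -> avoids6 (- p).
Proof. by move=> hp k hk h6; rewrite coefN hp ?oppr0. Qed.

(** A series in q^9 mixes only coefficients of [p] in the same class modulo 9; its constant term 1
    allows strong induction on the index. *)
Lemma avoids6_mul_X9 p q : q`_0 = 1 -> avoids6 (p * (q \Po 'X^9)) -> avoids6 p.
Proof.
move=> q0 h k; elim/ltn_ind: k => k IHk hk h6.
have := h k hk h6; rewrite mulrC coefM big_ord_recl subn0 coef_comp_poly_Xn //=.
rewrite div0n q0 mul1r big1 ?addr0 // => j _.
rewrite coef_comp_poly_Xn //; case: ifP => hj; last by rewrite mul0r.
by rewrite IHk ?mulr0 //; move: hj; have := ltn_ord j; rewrite /= /bump /=; lia.
Qed.

(** Squares are 0 or 1 modulo 3, so two of them with sum divisible by 3 are both divisible by 9,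
    which excludes sums 3 and 6 modulo 9. *)
Lemma coef_sq_theta_mod9 (s : R) m M k : (m == 1)%N || (m == 2)%N ->
  (k %% 9 == 3)%N || (k %% 9 == 6)%N -> (theta s m M ^+ 2)`_k = 0.
Proof.
move=> hm hk; rewrite expr2 coefM big1 // => i _.
have [hi|hi] := boolP ((i %% 9)%N \in [seq (m * a %% 9)%N | a <- [:: 0; 1; 4; 7]%N]);
  last by rewrite coef_theta_mod9 ?mul0r.
rewrite (@coef_theta_mod9 _ _ _ _ (k - i)) ?mulr0 //.
have := ltn_ord i; move: hi; case/orP: hm => /eqP -> /=; rewrite !inE; lia.
Qed.

End SixModNine.

(** The cube is a series in q^3 whose exponents are 0 or 3 modulo 9, so [q] would have to contribute
    an exponent 6 or 3 modulo 9. *)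
Lemma avoids6_cube_mul N (p q : {poly 'F_3}) :
  (forall k, (k %% 9 == 3)%N || (k %% 9 == 6)%N -> q`_k = 0) ->
  (forall k, (k %% 3 == 2)%N -> p`_k = 0) ->
  avoids6 N (p ^+ 3 * q).
Proof.
move=> hq hp k _ h6; rewrite frobenius_F3 coefM big1 // => i _.
rewrite coef_comp_poly_Xn //; case: ifP => h3; last by rewrite mul0r.
have [h2|h2] := boolP (i %/ 3 %% 3 == 2)%N; first by rewrite hp ?mul0r.
by rewrite hq ?mulr0 //; have := ltn_ord i; move: h2 h3; lia.
Qed.

(** * The three residual theta products modulo 3 *)

Section ModThree.
Variable N : nat.
Let p : {poly 'F_3} := theta 1 1 N.
Let P : {poly 'F_3} := theta (-1) 1 N.
Let P' : {poly 'F_3} := theta (-1) 2 N.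
Let s : {poly 'F_3} := theta 1 2 N.

Let pP : p * P =[N] P' ^+ 2. Proof. exact: theta_mulN. Qed.

Let coef_p k : (k %% 9)%N \notin [:: 0; 1; 4; 7]%N -> p`_k = 0.
Proof. by move=> h; apply: coef_theta_mod9. Qed.

Let avoids6_p3_sq q : (q = p ^+ 2) \/ (q = s ^+ 2) -> avoids6 N (p ^+ 3 * q).
Proof.
move=> hq; apply: avoids6_cube_mul => k hk.
  by case: hq => ->; exact: coef_sq_theta_mod9.
by apply: coef_p; move: hk; rewrite !inE; lia.
Qed.

Lemma avoids6_theta10 : avoids6 N (p ^+ 1 * P ^+ 0).
Proof. by rewrite expr1 expr0 mulr1 => k _ h6; apply: coef_p; rewrite h6. Qed.

Lemma avoids6_theta32 : avoids6 N (p ^+ 3 * P ^+ 2).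
Proof.
have -> : p ^+ 3 * P ^+ 2 = p ^+ 3 * (p ^+ 2 + P ^+ 2) - p ^+ 3 * p ^+ 2 by ring.
rewrite theta_sq_addN mulrnAr mulr2n.
by do ![apply: avoids6D | apply: avoids6N]; apply: avoids6_p3_sq; [right|right|left].
Qed.

(** By [theta_pow4_addN] the product becomes [- p ^+ 5 - p ^+ 9], and the ninth power is a series in
    q^9. *)
Lemma avoids6_theta54 : avoids6 N (p ^+ 5 * P ^+ 4).
Proof.
have -> : p ^+ 5 * P ^+ 4 = p ^+ 5 * (p ^+ 4 + P ^+ 4) - p ^+ 9 by ring.
rewrite theta_pow4_addN; last by apply/eqP.
rewrite mulrN1; apply: avoids6D; apply: avoids6N.
  have -> : p ^+ 5 = p ^+ 3 * p ^+ 2 by ring.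
  by apply: avoids6_p3_sq; left.
rewrite frobenius_sq_F3 => k _ h6; rewrite coef_comp_poly_Xn //; case: ifP => // h9.
by move: h6 h9; lia.
Qed.

(** Multiplying by [P' ^+ (9 * i)], a series in q^9, is harmless. Of this power, [c - 1] factors
    cancel against the generating function and the other [2(a+1)] become [(p * P) ^+ a.+1], one [P]
    of which cancels too. *)
Lemma coef_ovc_trunc_F3 c a i k : (2 <= c)%N ->
  avoids6 N (p ^+ a.+1 * P ^+ a) -> (a.+1.*2 + (c - 1) = 9 * i)%N ->
  (k <= N)%N -> (k %% 9 = 6)%N -> (map_poly intr (ovc_trunc c N) : {poly 'F_3})`_k = 0.
Proof.
move=> hc ha hi; move: k.
have hA := @ovc_trunc_theta_map 'F_3 c N hc.
apply: (@avoids6_mul_X9 _ _ _ (P' ^+ i)).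
  by elim: i {hi} => [|i IH]; rewrite ?expr0 ?coef1 // exprS coef0M coef0_theta // IH mulr1.
rewrite -frobenius_sq_F3 -exprM mulnC -hi exprD -mul2n exprM -pP.
suff -> : map_poly intr (ovc_trunc c N) * ((p * P) ^+ a.+1 * P' ^+ (c - 1))
    =[N] p ^+ a.+1 * P ^+ a by [].
transitivity (map_poly intr (ovc_trunc c N) * (P * P' ^+ (c - 1)) * (p ^+ a.+1 * P ^+ a)).
  by apply: eqX_eq; rewrite exprMn (exprS P); ring.
by rewrite hA mul1r.
Qed.

End ModThree.

Lemma abar_mod12 c a i n : (2 <= c)%N ->
  avoids6 (9 * n + 6) (theta (1 : 'F_3) 1 (9 * n + 6) ^+ a.+1
                       * theta (-1) 1 (9 * n + 6) ^+ a) ->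
  (a.+1.*2 + (c - 1) = 9 * i)%N ->
  (abar c (9 * n + 6) = 0 %[mod 12])%Z.
Proof.
move=> hc ha hi.
have d3 : (3 %| abar c (9 * n + 6))%Z.
  rewrite -(@intr_Zp_eq0 3) //.
  have := coef_ovc_trunc_F3 hc ha hi (leqnn _); rewrite coef_map => -> //.
  by lia.
have d4 : (4 %| abar c (9 * n + 6))%Z.
  rewrite -(@intr_Zp_eq0 4) //.
  have := @coef_ovc_trunc_char4 'Z_4 c n; rewrite coef_map => -> //.
  by apply/eqP.
by apply/eqP; rewrite eqz_mod_dvd subr0 (@Gauss_dvdz 3 4) // d3.
Qed.

Theorem theorem1p9 (n i : nat) : (1 <= i)%N ->
  (abar (9 * i) (9 * n + 6) = 0 %[mod 12])%Z /\
  (abar (9 * i + 4) (9 * n + 6) = 0 %[mod 12])%Z /\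
  (abar (9 * i + 8) (9 * n + 6) = 0 %[mod 12])%Z.
Proof.
move=> hi; split; [|split].
(* In each family [a] is chosen so that [2(a+1) + c - 1] equals [9(i+1)]. *)
- by apply: (@abar_mod12 _ 4 i.+1); [lia | exact: avoids6_theta54 | lia].
- by apply: (@abar_mod12 _ 2 i.+1); [lia | exact: avoids6_theta32 | lia].
- by apply: (@abar_mod12 _ 0 i.+1); [lia | exact: avoids6_theta10 | lia].
Qed.
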